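(* Let $n\ge 1$ and let $\beta$ be a braid on $n$ strands with exponent sum $w$, and let $\Delta=\Delta_n$ be the Garside positive half-twist braid on $n$ strands, so that $\beta\Delta^2$ is a braid on $n$ strands with exponent sum $w+n(n-1)$. Then the lower Morton--Franks-Williams estimate is sharp for $\beta$ (i.e. the lowest power of $v$ occurring with non-zero coefficient in $P_{\widehat\beta}(v,z)$ is exactly $v^{w-n+1}$) if and only if the upper Morton--Franks-Williams estimate is sharp for $\beta\Delta^2$ (i.e. the highest power of $v$ occurring with non-zero coefficient in $P_{\widehat{\beta\Delta^2}}(v,z)$ is exactly $v^{w+n^2-1}$). Moreover, if this is the case, then the left column of $P_{\widehat\beta}$ equals $(-1)^{n-1}$ times the right column of $P_{\widehat{\beta\Delta^2}}$; that is, the coefficient (a Laurent polynomial in $z$) of $v^{w-n+1}$ in $P_{\widehat\beta}$ equals $(-1)^{n-1}$ times the coefficient of $v^{w+n^2-1}$ in $P_{\widehat{\beta\Delta^2}}$.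
   Context: For a braid $\gamma$, $\widehat\gamma$ denotes its usual closure, oriented by orienting the strands of $\gamma$ in the braid direction. The Homfly polynomial $P_L(v,z)\in\mathbb{Z}[v^{\pm1},z^{\pm1}]$ of an oriented link $L$ is the isotopy invariant with $P=1$ on the unknot and skein relation $v^{-1}P_{L_+}-vP_{L_-}=zP_{L_0}$ (with $L_+,L_-,L_0$ differing at one crossing which is positive, negative, resp. smoothed). Equivalently $P_D=v^{\mathrm{writhe}(D)}H_D$, where $H$ is the framed Homfly polynomial (regular isotopy invariant with $H_{L_+}-H_{L_-}=zH_{L_0}$, a positive kink multiplying $H$ by $v$, a negative kink by $v^{-1}$, and $H=1$ on the crossingless unknot diagram). The Morton--Franks-Williams inequalities state that for a braid on $n$ strands with exponent sum $w$, every power of $v$ occurring in the Homfly polynomial of its closure lies between $v^{w-n+1}$ (lower estimate) and $v^{w+n-1}$ (upper estimate). The ''left column'' (resp. ''right column'') of a Homfly polynomial is the coefficient of its lowest (resp. highest) power of $v$, viewed as a Laurent polynomial in $z$. *)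

(* Defs.v *)
From mathcomp Require Import all_boot all_algebra.
Set Implicit Arguments. Unset Strict Implicit. Unset Printing Implicit Defensive.
Import GRing.Theory Num.Theory.
Local Open Scope ring_scope.

(* A braid generator: (i, true) is sigma_i, (i, false) is sigma_i^{-1}  (i >= 1). *)
Definition gen := (nat * bool)%type.
(* A braid is given by a word in the Artin generators. *)
Definition word := seq gen.

(* the word uses only generators sigma_1 .. sigma_{n-1}: it is a braid on n strands *)
Definition valid (n : nat) (w : word) : bool :=
  all (fun g : gen => (0 < g.1)%N && (g.1 < n)%N) w.

Definition expsum (w : word) : int :=
  \sum_(g <- w) (if g.2 then 1 else -1).

(* Garside half twist Delta_n = (s1 ... s_{n-1})(s1 ... s_{n-2}) ... (s1) *)
Definition delta_word (n : nat) : word :=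
  flatten [seq [seq ((i.+1)%N, true) | i <- iota 0 k] | k <- rev (iota 1 (n.-1))].

(* An element of Z[v^{+-1}, z^{+-1}] is represented by its coefficient
   function:  c a b  = coefficient of v^a z^b  (finitely supported). *)
Definition laurent2 := int -> int -> int.

Definition fin_supp (c : laurent2) : Prop :=
  exists N : nat, forall a b : int,
    ((N%:Z < `|a|%:Z) || (N%:Z < `|b|%:Z)) -> c a b = 0.

(* Characterization of the Homfly polynomial of braid closures:
   P n w = Homfly polynomial of the closure of the n-strand braid word w.
   Invariance under braid relations, conjugation and Markov stabilisation
   (Markov's theorem: closures are isotopic iff the braids are related by
   these moves), the skein relation  v^{-1} P_+ - v P_- = z P_0 ,
   and P(unknot) = 1.  These properties determine P uniquely. *)
Definition is_homfly (P : nat -> word -> laurent2) : Prop :=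
  (forall n w, valid n w -> fin_supp (P n w)) /\
      (forall a b, P 1%N [::] a b = if (a == 0) && (b == 0) then 1 else 0) /\
      (forall n a b i e, valid n (a ++ b) -> (0 < i < n)%N ->
          P n (a ++ (i, e) :: (i, ~~ e) :: b) = P n (a ++ b)) /\
      (forall n a b i j e f, valid n (a ++ (i, e) :: (j, f) :: b) ->
          (i.+1 < j)%N || (j.+1 < i)%N ->
          P n (a ++ (i, e) :: (j, f) :: b) = P n (a ++ (j, f) :: (i, e) :: b)) /\
      (forall n a b i, valid n (a ++ b) -> (0 < i)%N -> (i.+1 < n)%N ->
          P n (a ++ [:: (i, true); (i.+1, true); (i, true)] ++ b)
          = P n (a ++ [:: (i.+1, true); (i, true); (i.+1, true)] ++ b)) /\
      (forall n g w, valid n (g :: w) -> P n (g :: w) = P n (rcons w g)) /\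
      (forall n w e, (0 < n)%N -> valid n w -> P n.+1 (rcons w (n, e)) = P n w) /\
      (* skein relation v^{-1} P_+ - v P_- = z P_0, coefficientwise *)
      (forall n a b i, valid n (a ++ b) -> (0 < i < n)%N ->
          forall x y : int,
          P n (a ++ (i, true) :: b) (x + 1) y - P n (a ++ (i, false) :: b) (x - 1) y
          = P n (a ++ b) x (y - 1)).

(* Main.v *)
(** After shifting powers of [v] by the writhe, every coefficient of the Homfly
    polynomial of an [n]-strand closed braid is a trace on the Hecke algebra
    [s - 1/s = z].  Such a trace is determined by its values on [w] and
    [w s_n] for [w] on [n] strands, which yields the Morton--Franks--Williams
    bounds by induction, together with recursions for the two extreme columns:
    the leftmost one satisfies [L (w s_n) = L w] and [z L w = L w], while the
    rightmost one satisfies [U (w s_n) = 0] and [z U w = - U w] (with one strand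
    more on the left of each equation).  The full twist is the product of the
    full twist on one strand less and of the loop [s_n ... s_1 s_1 ... s_n].
    Resolving one of the two middle crossings of the loop gives a shorter loop
    plus a term which by braid relations contains [s_n] once, so is killed by [U].
    Hence inserting the loop does not change [U], and [w |-> (-1)^(n-1) U (w Delta^2)]
    satisfies the recursion of [L]. *)
Require Import Defs.
From mathcomp Require Import all_boot all_algebra.
From mathcomp Require Import zify ring.
From Stdlib Require Import Setoid Morphisms.
Import GRing.Theory Num.Theory.
Local Open Scope ring_scope.

(** * Words up to the relations of the braid group *)

(** An inductive congruence allows setoid rewriting as well as induction on derivations, by which
    [P] is shown to respect it. *)
Inductive beq (n : nat) : word -> word -> Prop :=
| beq_refl u : beq n u u
| beq_sym u v : beq n u v -> beq n v u
| beq_trans u v t : beq n u v -> beq n v t -> beq n u t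
| beq_ctx a b u v : beq n u v -> beq n (a ++ u ++ b) (a ++ v ++ b)
| beq_cancel i e : (0 < i < n)%N -> beq n [:: (i, e); (i, ~~ e)] [::]
| beq_far i j e f : (0 < i < n)%N -> (0 < j < n)%N ->
    (i.+1 < j)%N || (j.+1 < i)%N ->
    beq n [:: (i, e); (j, f)] [:: (j, f); (i, e)]
| beq_braid i : (0 < i)%N -> (i.+1 < n)%N ->
    beq n [:: (i, true); (i.+1, true); (i, true)]
          [:: (i.+1, true); (i, true); (i.+1, true)].

#[export] Instance beq_equiv n : Equivalence (beq n).
Proof. split; [exact: beq_refl | exact: beq_sym | exact: beq_trans]. Qed.

#[export] Instance cat_beq n :
  Proper (beq n ==> beq n ==> beq n) (@cat gen).
Proof.
move=> u u' uu' v v' vv'; apply: (@beq_trans _ _ (u' ++ v)).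
  exact: (@beq_ctx n [::] v _ _ uu').
by have := @beq_ctx n u' [::] _ _ vv'; rewrite !cats0.
Qed.

Lemma valid_cat n a b : valid n (a ++ b) = valid n a && valid n b.
Proof. exact: all_cat. Qed.

Lemma valid_cons n g a :
  valid n (g :: a) = (0 < g.1)%N && (g.1 < n)%N && valid n a.
Proof. by []. Qed.

Lemma valid_widen m n w : (m <= n)%N -> valid m w -> valid n w.
Proof.
move=> le_mn; apply: sub_all => g /andP[-> /= lt_gm].
exact: leq_trans lt_gm le_mn.
Qed.

Lemma valid1 w : valid 1 w -> w = [::].
Proof. by case: w => // g w; rewrite valid_cons; case: g.1 => [|[|k]]. Qed.

Lemma beq_valid n u v : beq n u v -> valid n u = valid n v.
Proof.
elim=> {u v} // [u v t _ -> //| a b u v _ IH|i e|i j e f|i].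
- by rewrite !valid_cat IH.
- by move=> Hi; rewrite !valid_cons /= Hi.
- by move=> Hi Hj _; rewrite !valid_cons /= Hi Hj.
- by move=> Hi Hj; rewrite !valid_cons /=; lia.
Qed.

Lemma beq_widen m n u v : (m <= n)%N -> beq m u v -> beq n u v.
Proof.
move=> le_mn; elim=> {u v} [u|u v _|u v t _ IH1 _|a b u v _|i e|i j e f|i].
- by reflexivity.
- exact: beq_sym.
- exact: beq_trans.
- exact: beq_ctx.
- by move=> Hi; apply: beq_cancel; lia.
- by move=> Hi Hj Hij; apply: beq_far => //; lia.
- by move=> Hi Hj; apply: beq_braid => //; lia.
Qed.

Lemma expsum_cat a b : expsum (a ++ b) = expsum a + expsum b.
Proof. by rewrite /expsum big_cat. Qed.

Lemma expsum_cons g a : expsum (g :: a) = (if g.2 then 1 else -1) + expsum a.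
Proof. by rewrite /expsum big_cons. Qed.

Lemma expsum_nil : expsum [::] = 0.
Proof. by rewrite /expsum big_nil. Qed.

Lemma expsum_beq n u v : beq n u v -> expsum u = expsum v.
Proof.
elim=> {u v} // [u v t _ -> //| a b u v _ IH|i e _|i j e f _ _ _|i _ _].
- by rewrite !expsum_cat IH.
- by rewrite !expsum_cons expsum_nil; case: e => /=; ring.
- by rewrite !expsum_cons addrCA.
- by rewrite !expsum_cons.
Qed.

(** * Commutation in the braid group *)

Definition bcomm (n : nat) (u v : word) : Prop := beq n (u ++ v) (v ++ u).

Lemma bcomm_sym n u v : bcomm n u v -> bcomm n v u.
Proof. exact: beq_sym. Qed.

Lemma bcomm_nil n u : bcomm n u [::].
Proof. by rewrite /bcomm cats0; reflexivity. Qed.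

Lemma bcomm_catr n u v w : bcomm n u v -> bcomm n u w -> bcomm n u (v ++ w).
Proof. by rewrite /bcomm => uv uw; rewrite catA uv -catA uw catA; reflexivity. Qed.

Lemma bcomm_catl n u v w : bcomm n u w -> bcomm n v w -> bcomm n (u ++ v) w.
Proof. by move=> uw vw; apply/bcomm_sym/bcomm_catr; apply: bcomm_sym. Qed.

Lemma bcomm_inv n u i e : (0 < i < n)%N ->
  bcomm n u [:: (i, e)] -> bcomm n u [:: (i, ~~ e)].
Proof.
move=> Hi; rewrite /bcomm => c.
have c1 : beq n [::] ([:: (i, ~~ e)] ++ [:: (i, e)]).
  by symmetry; have := @beq_cancel n i (~~ e) Hi; rewrite negbK.
have c2 : beq n ([:: (i, e)] ++ [:: (i, ~~ e)]) [::] by apply: beq_cancel.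
transitivity (([:: (i, ~~ e)] ++ [:: (i, e)]) ++ u ++ [:: (i, ~~ e)]).
  by rewrite -c1; reflexivity.
rewrite -catA [X in beq n (_ ++ X) _]catA -c -catA c2 cats0; reflexivity.
Qed.

Lemma bcomm_word n m u w : (m <= n)%N ->
  (forall i, (0 < i < m)%N -> bcomm n u [:: (i, true)]) ->
  valid m w -> bcomm n u w.
Proof.
move=> le_mn Hu; elim: w => [|[i e] w IH]; first by move=> _; exact: bcomm_nil.
rewrite valid_cons => /andP[/= Hi /IH Hw].
rewrite -cat1s; apply: bcomm_catr Hw.
case: e; first exact: Hu.
by apply: (@bcomm_inv n u i true); [lia | exact: Hu].
Qed.

Lemma bcomm_far n m j e w : (m < j < n)%N -> valid m w ->
  bcomm n [:: (j, e)] w.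
Proof.
move=> Hj; apply: bcomm_word => [|i Hi]; first lia.
by apply: beq_far; lia.
Qed.

(** The letters of [c] and [d] commute with [s_m.+1], so both outer letters slide inward to [s_m],
    where the braid relation leaves [s_m.+1] only once. *)
Lemma braid_sandwich n m c d : (0 < m)%N -> (m.+1 < n)%N ->
  valid m c -> valid m d ->
  beq n ([:: (m.+1, true)] ++ (c ++ [:: (m, true)] ++ d) ++ [:: (m.+1, true)])
        ((c ++ [:: (m, true)]) ++ [:: (m.+1, true)] ++ [:: (m, true)] ++ d).
Proof.
move=> m_gt0 Hn vc vd.
have far w : valid m w ->
    beq n ([:: (m.+1, true)] ++ w) (w ++ [:: (m.+1, true)]).
  by apply: bcomm_far; lia.
have br : beq n ([:: (m, true)] ++ [:: (m.+1, true)] ++ [:: (m, true)])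
                ([:: (m.+1, true)] ++ [:: (m, true)] ++ [:: (m.+1, true)]).
  by apply: beq_braid; lia.
move: far br; set s := [:: (m, true)]; set t := [:: (m.+1, true)] => far br.
transitivity ((t ++ c) ++ s ++ d ++ t); first by rewrite -!catA; reflexivity.
rewrite (far _ vc) -(far _ vd).
transitivity (c ++ (t ++ s ++ t) ++ d); first by rewrite -!catA; reflexivity.
by rewrite -br -!catA; reflexivity.
Qed.

(** * Loops and the full twist *)

(* The pure braid in which strand [m.+1] encircles all the previous ones. *)
Fixpoint loop (m : nat) : word :=
  if m is k.+1 then [:: (m, true)] ++ loop k ++ [:: (m, true)] else [::].

Fixpoint full_twist (m : nat) : word :=
  if m is k.+1 then loop m ++ full_twist k else [::].

Lemma loopS m : loop m.+1 = [:: (m.+1, true)] ++ loop m ++ [:: (m.+1, true)].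
Proof. by []. Qed.

Lemma full_twistS m : full_twist m.+1 = loop m.+1 ++ full_twist m.
Proof. by []. Qed.

Lemma valid_loop m : valid m.+1 (loop m).
Proof.
elim: m => // m IH; rewrite loopS !valid_cat !valid_cons /= !ltnSn /= andbT.
exact: valid_widen IH.
Qed.

Lemma valid_full_twist m : valid m.+1 (full_twist m).
Proof.
elim: m => // m IH; rewrite full_twistS valid_cat valid_loop.
exact: valid_widen IH.
Qed.

(** If [s_i] is far from the outermost letter, induction applies. Otherwise, with [t] outermost, [s]
    next and [L] the inner loop, [t s L s t s = t s L t s t = t s t L s t = s t s L s t]. *)
Lemma loop_comm_gen n m i : (m.+1 < n)%N -> (0 < i <= m)%N ->
  bcomm n (loop m.+1) [:: (i, true)].
Proof.
elim: m i => [|m IH] i Hn Hi; first lia.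
have [le_im|lt_mi] := leqP i m.
  have far : bcomm n [:: (m.+2, true)] [:: (i, true)].
    by apply: (@bcomm_far n m.+1); rewrite ?valid_cons /=; lia.
  rewrite loopS; apply: bcomm_catl => //; apply: bcomm_catl => //.
  by apply: IH; lia.
have -> : i = m.+1 by lia.
have far : bcomm n [:: (m.+2, true)] (loop m).
  by apply: (@bcomm_far n m.+1); [lia | exact: valid_loop].
have br : beq n ([:: (m.+1, true)] ++ [:: (m.+2, true)] ++ [:: (m.+1, true)])
                ([:: (m.+2, true)] ++ [:: (m.+1, true)] ++ [:: (m.+2, true)]).
  by apply: beq_braid; lia.
rewrite /bcomm !loopS.
set s := [:: (m.+1, true)] in br *; set t := [:: (m.+2, true)] in br far *.
rewrite /bcomm in far.
transitivity (t ++ s ++ loop m ++ (s ++ t ++ s)).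
  by rewrite -!catA; reflexivity.
rewrite br [X in beq n (_ ++ _ ++ X) _]catA -far.
transitivity ((t ++ s ++ t) ++ loop m ++ s ++ t).
  by rewrite -!catA; reflexivity.
rewrite -br -!catA; reflexivity.
Qed.

Lemma loop_comm n m w : (m.+1 < n)%N -> valid m.+1 w -> bcomm n (loop m.+1) w.
Proof.
move=> Hn; apply: bcomm_word => [|i Hi]; first lia.
by apply: loop_comm_gen; lia.
Qed.

Lemma full_twist_comm n m w : (m < n)%N -> valid m.+1 w ->
  bcomm n (full_twist m) w.
Proof.
move=> Hn; apply: bcomm_word => // i.
elim: m Hn i => [|m IH] Hn i Hi; first lia.
rewrite full_twistS.
have [lt_im|le_mi] := ltnP i m.+1.
  by apply: bcomm_catl; [apply: loop_comm_gen; lia | apply: IH; lia].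
have -> : i = m.+1 by lia.
case: m IH Hn Hi le_mi => [|m] IH Hn Hi le_mi.
  by rewrite cats0; exact: beq_refl.
rewrite full_twistS catA; apply: bcomm_catl; last first.
  by apply/bcomm_sym/(@bcomm_far n m.+1); [lia | exact: valid_full_twist].
(* With [s] the top generator and [l = loop m.+1], this says [s l s l = l s l s], whence [s]
   commutes with [s l s l]. *)
have: bcomm n (loop m.+2) (loop m.+1).
  by apply: loop_comm; [lia | exact: valid_loop].
rewrite /bcomm (loopS m.+1); set s := [:: _]; set l := loop m.+1.
rewrite -!catA => c.
by rewrite -c; reflexivity.
Qed.

(** * The half twist and its square *)

Lemma iotaSr m k : iota m k.+1 = iota m k ++ [:: (m + k)%N].
Proof. by rewrite -[in LHS]addn1 iotaD. Qed.

Definition ascending (k : nat) : word := [seq (i.+1, true) | i <- iota 0 k].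

Lemma ascendingS k : ascending k.+1 = ascending k ++ [:: (k.+1, true)].
Proof. by rewrite /ascending iotaSr map_cat. Qed.

Lemma rev_ascendingS k :
  rev (ascending k.+1) = [:: (k.+1, true)] ++ rev (ascending k).
Proof. by rewrite ascendingS rev_cat. Qed.

Lemma loopE m : loop m = rev (ascending m) ++ ascending m.
Proof.
elim: m => // m IH; rewrite loopS IH rev_ascendingS ascendingS.
by rewrite -!catA.
Qed.

Lemma delta_wordS m :
  delta_word m.+2 = ascending m.+1 ++ delta_word m.+1.
Proof.
by rewrite /delta_word [m.+2.-1]/= iotaSr rev_cat.
Qed.

Lemma valid_ascending m : valid m.+1 (ascending m).
Proof.
elim: m => // m IH; rewrite ascendingS valid_cat valid_cons /= !ltnSn /= andbT.
exact: valid_widen IH.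
Qed.

Lemma valid_delta_word m : valid m.+1 (delta_word m.+1).
Proof.
elim: m => // m IH; rewrite delta_wordS valid_cat valid_ascending.
exact: valid_widen IH.
Qed.

(** The definition splits off an ascending word on the left; its last letter slides right past the
    half twist on two strands less. *)
Lemma delta_word_descending m :
  beq m.+2 (delta_word m.+2) (delta_word m.+1 ++ rev (ascending m.+1)).
Proof.
elim: m => [|m IH]; first by rewrite delta_wordS; exact: beq_refl.
have c : bcomm m.+3 [:: (m.+2, true)] (delta_word m.+1).
  by apply: (@bcomm_far _ m.+1); [lia | exact: valid_delta_word].
rewrite /bcomm in c.
rewrite [delta_word m.+3]delta_wordS {1}(beq_widen _ _ _ _ (leqnSn _) IH).
rewrite (rev_ascendingS m.+1) (ascendingS m.+1) -catA.
rewrite [X in beq _ (_ ++ X) _]catA c delta_wordS -!catA; reflexivity.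
Qed.

(** With the left factor in descending and the right one in ascending form, a loop appears between
    two copies of [delta_word m.+1] and commutes with them. *)
Lemma delta_sqr m :
  beq m.+1 (delta_word m.+1 ++ delta_word m.+1) (full_twist m).
Proof.
elim: m => [|m IH]; first exact: beq_refl.
transitivity
  ((delta_word m.+1 ++ rev (ascending m.+1)) ++ ascending m.+1 ++ delta_word m.+1).
  by rewrite -delta_word_descending -delta_wordS; reflexivity.
rewrite full_twistS -(beq_widen _ _ _ _ (leqnSn _) IH).
have c : bcomm m.+2 (loop m.+1) (delta_word m.+1).
  by apply: loop_comm; [lia | exact: valid_delta_word].
rewrite /bcomm in c.
by rewrite -catA [X in beq _ (_ ++ X) _]catA -loopE catA -c -catA; reflexivity.
Qed.

Lemma expsum_loop m : expsum (loop m) = m.*2%:Z.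
Proof.
elim: m => [|m IH]; first exact: expsum_nil.
by rewrite loopS !expsum_cat IH !expsum_cons expsum_nil /=; lia.
Qed.

Lemma expsum_full_twist m : expsum (full_twist m) = (m * m.+1)%N%:Z.
Proof.
elim: m => [|m IH]; first exact: expsum_nil.
by rewrite full_twistS expsum_cat IH expsum_loop; lia.
Qed.

(** * Functionals on the Hecke algebra *)

(* [f w y] is the coefficient of [z ^ y]: these are the [Z[z, 1/z]]-linear
   functionals on the Hecke algebra with quadratic relation [s - 1/s = z]. *)
Definition hecke_functional (n : nat) (f : word -> int -> int) : Prop :=
  (forall u v, beq n u v -> valid n u -> f u =1 f v) /\
  (forall a b i, valid n (a ++ b) -> (0 < i < n)%N -> forall y,
     f (a ++ [:: (i, true)] ++ b) y - f (a ++ [:: (i, false)] ++ b) y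
     = f (a ++ b) (y - 1)).

Lemma hecke_functional_ctx n m f a b : (m <= n)%N -> valid n a -> valid n b ->
  hecke_functional n f -> hecke_functional m (fun x => f (a ++ x ++ b)).
Proof.
move=> le_mn va vb [fb fs]; split=> [u v uv vu y|a' b' i vab Hi y].
  apply: fb; last by rewrite !valid_cat va vb (valid_widen _ _ _ le_mn vu).
  exact/beq_ctx/(beq_widen _ _ _ _ le_mn).
have := @fs (a ++ a') (b' ++ b) i; rewrite -!catA => -> //; last lia.
move: vab => /(valid_widen _ _ _ le_mn); rewrite !valid_cat va vb.
by case/andP=> -> ->.
Qed.

(** This is [s - 1/s = z] multiplied by [s]. *)
Lemma hecke_sqr n f i a b : hecke_functional n f -> (0 < i < n)%N ->
  valid n a -> valid n b -> forall y,
  f (a ++ [:: (i, true)] ++ [:: (i, true)] ++ b) y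
  = f (a ++ b) y + f (a ++ [:: (i, true)] ++ b) (y - 1).
Proof.
move=> [fb fs] Hi va vb y.
have /fs - /(_ i Hi y) : valid n ((a ++ [:: (i, true)]) ++ b).
  by rewrite !valid_cat va vb valid_cons /= Hi.
rewrite -!catA => <-.
have <- : f (a ++ [:: (i, true)] ++ [:: (i, false)] ++ b) y = f (a ++ b) y.
  apply: fb; last by rewrite !valid_cat va vb !valid_cons /= Hi.
  exact: (@beq_ctx n a b _ [::] (@beq_cancel n i true Hi)).
by rewrite addrC subrK.
Qed.

Lemma hecke_inv_vanish n f i a b : hecke_functional n f -> (0 < i < n)%N ->
  valid n a -> valid n b -> f (a ++ b) =1 (fun=> 0) ->
  forall y, f (a ++ [:: (i, false)] ++ b) y = f (a ++ [:: (i, true)] ++ b) y.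
Proof.
move=> [fb fs] Hi va vb f0 y; apply/esym/eqP; rewrite -subr_eq0 fs ?f0 //.
by rewrite valid_cat va.
Qed.

(* The Hecke algebra on [m.+2] strands is spanned by words containing the last
   generator at most once; inside [s_m.+1 b s_m.+1] this is applied to [b]. *)
Lemma hecke_span m f : hecke_functional m.+1 f ->
  (forall a, valid m a -> f a =1 (fun=> 0)) ->
  (forall a b, (0 < m)%N -> valid m a -> valid m b ->
     f (a ++ [:: (m, true)] ++ b) =1 (fun=> 0)) ->
  forall w, valid m.+1 w -> f w =1 (fun=> 0).
Proof.
elim: m f => [|m IHm] f Hf f0 f1 w.
  by move/valid1 ->; apply: f0.
(* The last letter is absorbed into the functional, hence [f] varies in the induction. *)
elim/last_ind: w f Hf f0 f1 => [|w [i e] IHw] f Hf f0 f1.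
  by move=> _; exact: f0.
rewrite -cats1 valid_cat valid_cons /= andbT => /andP[vw Hi] y.
have Hg := @hecke_functional_ctx m.+2 m.+2 f [::] [:: (i, e)] (leqnn _) isT.
rewrite valid_cons /= Hi in Hg; move/(_ isT Hf): Hg => /= Hg.
have wid c : valid m.+1 c -> valid m.+2 c by apply: valid_widen.
have [lt_im|le_mi] := ltnP i m.+1.
  have vi : valid m.+1 [:: (i, e)] by rewrite valid_cons /=; lia.
  apply: (IHw _ Hg) => // [a va|a b _ va vb].
    by apply: f0; rewrite valid_cat va.
  by rewrite -!catA; apply: f1; rewrite ?valid_cat ?vb.
have Ei : i = m.+1 by lia.
subst i.
apply: (IHw _ Hg) => // {w IHw vw y} [a va y|a b _ va vb y].
  have E : f (a ++ [:: (m.+1, true)]) y = 0 by apply: (f1 a [::]).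
  case: e Hg => // Hg.
  have := @hecke_inv_vanish m.+2 f m.+1 a [::] Hf Hi (wid _ va) isT.
  by rewrite !cats0 => -> //; exact: f0.
have vs : valid m.+2 [:: (m.+1, true)] by rewrite valid_cons /= !ltnSn.
(* An inverse last letter may be made positive, since the word without it is killed by [f1]. *)
suff {y} : forall y,
    f ((a ++ [:: (m.+1, true)] ++ b) ++ [:: (m.+1, true)]) y = 0.
  case: e {Hg} => //.
  have := @hecke_inv_vanish m.+2 f m.+1 (a ++ [:: (m.+1, true)] ++ b) [::] Hf Hi.
  rewrite !cats0 => -> //; last exact: f1.
  by rewrite !valid_cat vs !wid.
have {Hg} Hg := @hecke_functional_ctx m.+2 m.+1 f (a ++ [:: (m.+1, true)])
  [:: (m.+1, true)] (leqnSn _).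
rewrite valid_cat vs (wid _ va) in Hg; move/(_ isT isT Hf): Hg => Hg y.
rewrite -catA -[in LHS]catA [X in f X y]catA; apply: (IHm _ Hg _ _ b vb y).
  move=> c vc x.
  have vc1 := @valid_widen m m.+1 c (leqnSn _) vc.
  (* Without [s_m], [c] commutes with [s_m.+1], and the two outer letters meet in a square. *)
  transitivity (f ((a ++ c) ++ [:: (m.+1, true)] ++ [:: (m.+1, true)] ++ [::]) x).
    apply: Hf.1; last by rewrite !valid_cat !vs !wid.
    have fc : bcomm m.+2 [:: (m.+1, true)] c by apply: bcomm_far vc; lia.
    rewrite /bcomm in fc.
    by rewrite -catA [X in beq _ (_ ++ X) _]catA fc -!catA; reflexivity.
  rewrite (@hecke_sqr m.+2) // ?valid_cat ?wid // f1 ?valid_cat ?va // cats0.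
  by rewrite f0 ?addr0 // valid_cat va.
move=> c d m_gt0 vc vd x.
have vc1 := @valid_widen m m.+1 c (leqnSn _) vc.
have vd1 := @valid_widen m m.+1 d (leqnSn _) vd.
have vt : valid m.+1 [:: (m, true)] by rewrite valid_cons /= m_gt0 ltnSn.
transitivity (f ((a ++ c ++ [:: (m, true)]) ++ [:: (m.+1, true)]
                 ++ [:: (m, true)] ++ d) x); last first.
  by apply: f1; rewrite ?valid_cat ?va ?vc1 ?vt.
apply: Hf.1; last by rewrite !valid_cat vs !wid.
by rewrite -catA braid_sandwich // -!catA; reflexivity.
Qed.

(** Induction is applied to [x |-> f (s x s)], [s] being the outermost letter: by [braid_sandwich]
    it kills words containing the next generator once. What remains is [s s = 1 + z s], whose last
    term is killed by [f]. *)
Lemma hecke_loop m f : hecke_functional m.+1 f ->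
  (forall a b, (0 < m)%N -> valid m a -> valid m b ->
     f (a ++ [:: (m, true)] ++ b) =1 (fun=> 0)) ->
  f (loop m) =1 f [::].
Proof.
elim: m f => [|m IHm] f Hf f1 y //.
have vs : valid m.+2 [:: (m.+1, true)] by rewrite valid_cons /= !ltnSn.
have Hg := @hecke_functional_ctx m.+2 m.+1 f [:: (m.+1, true)]
  [:: (m.+1, true)] (leqnSn _) vs vs Hf.
rewrite loopS (IHm _ Hg) => [|c d m_gt0 vc vd x].
  have Hm : (0 < m.+1 < m.+2)%N by lia.
  by have := @hecke_sqr m.+2 f m.+1 [::] [::] Hf Hm isT isT y;
    rewrite (f1 [::] [::]) // addr0.
have wid c' : valid m c' -> valid m.+1 c' by apply: valid_widen.
have vt : valid m.+1 [:: (m, true)] by rewrite valid_cons /= m_gt0 ltnSn.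
transitivity (f ((c ++ [:: (m, true)]) ++ [:: (m.+1, true)]
                 ++ [:: (m, true)] ++ d) x); last first.
  by apply: f1; rewrite ?valid_cat ?vt ?wid.
apply: Hf.1; last first.
  by rewrite !valid_cat vs !(@valid_widen m.+1 m.+2 _ (leqnSn _)) ?vt ?wid.
exact: braid_sandwich.
Qed.

(** * The columns of the Homfly polynomial *)

Section Homfly.
Variables (P : nat -> word -> laurent2) (HP : is_homfly P).

(* The coefficient of [v ^ k] in the framed Homfly polynomial; the framing turns
   the skein relation of [P] into one that does not mix powers of [v]. *)
Definition column (n : nat) (k : int) (w : word) (y : int) : int :=
  P n w (expsum w + k) y.

Lemma homfly_beq n u v a b : beq n u v ->
  valid n u -> valid n a -> valid n b ->
  P n (a ++ u ++ b) = P n (a ++ v ++ b).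
Proof.
have [_ [_ [Pcan [Pfar [Pbr _]]]]] := HP.
move=> uv; elim: uv a b => {u v}
  [u|u v uv IH|u v t uv IHu _ IHv|c d u v _ IH|i e Hi|i j e f Hi Hj Hij|i Hi Hi1]
  a b vu va vb //.
- by rewrite IH // (beq_valid _ _ _ uv).
- by rewrite IHu // IHv // -(beq_valid _ _ _ uv).
- move: vu; rewrite !valid_cat => /and3P[vc vu vd].
  have := IH (a ++ c) (d ++ b) vu; rewrite -!catA; apply.
    by rewrite valid_cat va.
  by rewrite valid_cat vd.
- by rewrite /= Pcan // valid_cat va.
- by rewrite /= Pfar // valid_cat !valid_cons va vb /= Hi Hj.
- by rewrite Pbr // valid_cat va.
Qed.

Lemma homfly_cyclic n a b : valid n a -> valid n b ->
  P n (a ++ b) = P n (b ++ a).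
Proof.
have [_ [_ [_ [_ [_ [Pcyc _]]]]]] := HP.
elim: a b => [|g a IH] b; first by rewrite cats0.
move=> + vb; rewrite valid_cons => /andP[vg va].
rewrite cat_cons Pcyc; last by rewrite valid_cons vg valid_cat va.
rewrite -cats1 -catA IH // ?cats1 ?cat_rcons //.
by rewrite -cats1 valid_cat vb valid_cons vg.
Qed.

Lemma column_functional n k : hecke_functional n (column n k).
Proof.
have [_ [_ [_ [_ [_ [_ [_ Psk]]]]]]] := HP.
split=> [u v uv vu y|a b i vab Hi y].
  rewrite /column (expsum_beq _ _ _ uv).
  by have := homfly_beq n u v [::] [::] uv vu isT isT; rewrite /= !cats0 => ->.
rewrite /column -(Psk n a b i vab Hi) !expsum_cat !expsum_cons expsum_nil /=.
congr (P n _ _ y - P n _ _ y); ring.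
Qed.

Lemma column_cyclic n k a b : valid n a -> valid n b ->
  column n k (a ++ b) =1 column n k (b ++ a).
Proof.
by move=> va vb y; rewrite /column homfly_cyclic // !expsum_cat [expsum a + _]addrC.
Qed.

Lemma column_stab_pos m k w : valid m.+1 w ->
  column m.+2 k (w ++ [:: (m.+1, true)]) =1 column m.+1 (k + 1) w.
Proof.
have [_ [_ [_ [_ [_ [_ [Pst _]]]]]]] := HP.
move=> vw y; rewrite /column cats1 Pst // -cats1 expsum_cat expsum_cons expsum_nil.
congr (P _ _ _ y); ring.
Qed.

Lemma column_stab_neg m k w : valid m.+1 w ->
  column m.+2 k (w ++ [:: (m.+1, false)]) =1 column m.+1 (k - 1) w.
Proof.
have [_ [_ [_ [_ [_ [_ [Pst _]]]]]]] := HP.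
move=> vw y; rewrite /column cats1 Pst // -cats1 expsum_cat expsum_cons expsum_nil.
congr (P _ _ _ y); rewrite /=; ring.
Qed.

(** The skein relation at the new crossing relates the two stabilisations of [w]; smoothing leaves a
    split unknot, which thus multiplies by [(1/v - v) / z]. *)
Lemma column_split m k w : valid m.+1 w -> forall y,
  column m.+2 k w (y - 1) = column m.+1 (k + 1) w y - column m.+1 (k - 1) w y.
Proof.
move=> vw y; rewrite -column_stab_pos // -column_stab_neg //.
have := (column_functional m.+2 k).2 w [::] m.+1; rewrite !cats0 => -> //.
  exact: valid_widen vw.
by rewrite ltnSn.
Qed.

(** In shifted exponents the bounds on [m.+1] strands are [-m] and [m]. In both cases of
    [hecke_span] one strand is removed and [k] moves by one, so it stays out of range. *)
Lemma morton_franks_williams m k w : (k < - m%:Z) || (m%:Z < k) -> valid m.+1 w ->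
  column m.+1 k w =1 (fun=> 0).
Proof.
elim: m k w => [|m IH] k w Hk.
  move/valid1 -> => y; rewrite /column expsum_nil add0r.
  have [_ [-> _]] := HP; case: eqP => // k0; lia.
apply: hecke_span; first exact: column_functional.
  move=> a va y; rewrite -[y](addrK 1) column_split //.
  by rewrite !IH ?subrr //; lia.
move=> a b _ va vb y.
have vs : valid m.+2 [:: (m.+1, true)] by rewrite valid_cons /= !ltnSn.
have wid c : valid m.+1 c -> valid m.+2 c by apply: valid_widen.
rewrite catA column_cyclic ?valid_cat ?vs ?wid // catA column_stab_pos.
  by apply: IH; rewrite ?valid_cat ?vb //; lia.
by rewrite valid_cat vb.
Qed.

(** * The rightmost column and the full twist *)

(** Rotating [s_m.+1] to the end and destabilising leads to column [m + 2] on [m + 1] strands,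
    beyond the bound [m]. *)
Lemma top_column_vanish m a b : valid m.+1 a -> valid m.+1 b ->
  column m.+2 m.+1 (a ++ [:: (m.+1, true)] ++ b) =1 (fun=> 0).
Proof.
move=> va vb y.
have vs : valid m.+2 [:: (m.+1, true)] by rewrite valid_cons /= !ltnSn.
have wid c : valid m.+1 c -> valid m.+2 c by apply: valid_widen.
rewrite catA column_cyclic ?valid_cat ?vs ?wid // catA column_stab_pos.
  by apply: morton_franks_williams; rewrite ?valid_cat ?vb //; lia.
by rewrite valid_cat vb.
Qed.

Lemma top_column_loop m a b : valid m.+1 a -> valid m.+1 b ->
  column m.+2 m.+1 (a ++ loop m.+1 ++ b) =1 column m.+2 m.+1 (a ++ b).
Proof.
move=> va vb.
have wid c : valid m.+1 c -> valid m.+2 c by apply: valid_widen.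
apply: (@hecke_loop m.+1 (fun x => column m.+2 m.+1 (a ++ x ++ b))).
  apply: (@hecke_functional_ctx m.+2) => //; try exact: wid.
  exact: column_functional.
move=> c d _ vc vd y /=; rewrite -!catA catA.
by apply: top_column_vanish; rewrite valid_cat ?va ?vd.
Qed.

Lemma top_column_full_twist m w : valid m.+1 w -> forall y,
  column m.+2 m.+1 (w ++ full_twist m.+1) (y - 1)
  = - column m.+1 m (w ++ full_twist m) y.
Proof.
move=> vw y; have vF := valid_full_twist m.
rewrite full_twistS top_column_loop // column_split ?valid_cat ?vw //.
rewrite morton_franks_williams ?valid_cat ?vw ?sub0r //; last lia.
by congr (- column _ _ _ _); lia.
Qed.

(** The loop's first letter meets the inserted [s]: with [L = loop m] and [F = full_twist m],
    [w s s L s F = w L s F + z w s L s F]. The first term contains [s] once and vanishes; the second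
    is [z] times [w] with the full twist. *)
Lemma top_column_gen_full_twist m w : valid m.+1 w ->
  column m.+2 m.+1 (w ++ [:: (m.+1, true)] ++ full_twist m.+1)
  =1 (fun y => - column m.+1 m (w ++ full_twist m) y).
Proof.
move=> vw y; have vF := valid_full_twist m.
have vl := valid_loop m.
have vs : valid m.+2 [:: (m.+1, true)] by rewrite valid_cons /= !ltnSn.
have wid c : valid m.+1 c -> valid m.+2 c by apply: valid_widen.
rewrite -top_column_full_twist // full_twistS loopS -!catA.
have Hm : (0 < m.+1 < m.+2)%N by lia.
have vlF : valid m.+2 (loop m ++ [:: (m.+1, true)] ++ full_twist m).
  by rewrite !valid_cat vs !wid.
rewrite (hecke_sqr _ _ _ _ _ (column_functional m.+2 m.+1) Hm (wid _ vw) vlF).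
by rewrite catA top_column_vanish ?add0r // valid_cat vw.
Qed.

(** * Comparison of the extreme columns *)

(** As a single functional, the difference of the two columns at [n = m.+1] can be fed to
    [hecke_span]. *)
Definition column_defect (m : nat) (w : word) (y : int) : int :=
  column m.+1 (- m%:Z) w y - (-1) ^+ m * column m.+1 m (w ++ full_twist m) y.

Lemma column_defect_functional m : hecke_functional m.+1 (column_defect m).
Proof.
have [b1 s1] := column_functional m.+1 (- m%:Z).
have [] := @hecke_functional_ctx m.+1 m.+1 _ [::] (full_twist m) (leqnn _) isT
  (valid_full_twist m) (column_functional m.+1 m).
rewrite /= => b2 s2; split=> [u v uv vu y|a b i vab Hi y].
  by rewrite /column_defect (b1 _ _ uv) // (b2 _ _ uv).
by rewrite /column_defect -(s1 _ _ _ vab Hi) -(s2 _ _ _ vab Hi); ring.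
Qed.

(** The full twist is central, so appending it keeps the trace property. *)
Lemma column_defect_cyclic m a b : valid m.+1 a -> valid m.+1 b ->
  column_defect m (a ++ b) =1 column_defect m (b ++ a).
Proof.
move=> va vb y; rewrite /column_defect column_cyclic //.
have vF := valid_full_twist m.
congr (_ - _ * _); rewrite -catA column_cyclic ?valid_cat ?vb // -catA.
apply: (column_functional m.+1 m).1; last by rewrite !valid_cat va vb vF.
have c : beq m.+1 (full_twist m ++ a) (a ++ full_twist m).
  exact: full_twist_comm.
by rewrite c catA; reflexivity.
Qed.

Lemma column_defect0 m w : valid m.+1 w -> column_defect m w =1 (fun=> 0).
Proof.
elim: m w => [|m IH] w.
  by move/valid1 -> => y; rewrite /column_defect /= expr0 mul1r oppr0 subrr.
have IH' c y : valid m.+1 c -> column m.+1 (- m%:Z) c y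
    = (-1) ^+ m * column m.+1 m (c ++ full_twist m) y.
  by move=> vc; apply/eqP; rewrite -subr_eq0; apply/eqP; apply: IH.
apply: hecke_span; first exact: column_defect_functional.
  (* Writing [y] as [y + 1 - 1] exposes the factor [z]. Column [- m - 2] is out of range, and
     [(-1) ^+ m.+1] absorbs the sign from the right column. *)
  move=> a va y; rewrite -[y](addrK 1) /column_defect top_column_full_twist //.
  rewrite column_split // (morton_franks_williams m (- m.+1%:Z - 1)) ?subr0 //; last lia.
  rewrite (_ : - m.+1%:Z + 1 = - m%:Z); last lia.
  by rewrite IH' // exprS; ring.
move=> a b _ va vb y.
have vs : valid m.+2 [:: (m.+1, true)] by rewrite valid_cons /= !ltnSn.
have wid c : valid m.+1 c -> valid m.+2 c by apply: valid_widen.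
(* With the top generator rotated to the end, both columns reduce to [b ++ a] on one strand less. *)
rewrite catA column_defect_cyclic ?valid_cat ?vs ?wid // catA.
have vba : valid m.+1 (b ++ a) by rewrite valid_cat vb.
rewrite /column_defect column_stab_pos // -catA top_column_gen_full_twist //.
rewrite (_ : - m.+1%:Z + 1 = - m%:Z); last lia.
by rewrite IH' // exprS; ring.
Qed.

End Homfly.

Theorem theorem1p3 (P : nat -> word -> laurent2) (HP : is_homfly P)
  (n : nat) (beta : word) :
  (1 <= n)%N -> valid n beta ->
  let w := expsum beta in
  let lo := w - n%:Z + 1 in
  let hi := w + (n ^ 2)%:Z - 1 in
  let Pb := P n beta in
  let Pd := P n (beta ++ delta_word n ++ delta_word n) in
  (((exists b, Pb lo b != 0) /\ (forall a b, a < lo -> Pb a b = 0)) <->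
   ((exists b, Pd hi b != 0) /\ (forall a b, hi < a -> Pd a b = 0)))
  /\
  (((exists b, Pb lo b != 0) /\ (forall a b, a < lo -> Pb a b = 0)) ->
   forall b, Pb lo b = (-1) ^+ (n.-1) * Pd hi b).
Proof.
case: n => // m _ vb w lo hi Pb Pd.
have vF := valid_full_twist m.
have eD := expsum_full_twist m.
have EPd : Pd = P m.+1 (beta ++ full_twist m).
  have := homfly_beq P HP m.+1 _ _ beta [::] (delta_sqr m).
  by rewrite !cats0; apply=> //; rewrite valid_cat !valid_delta_word.
have lo0 a b : a < lo -> Pb a b = 0.
  move=> lt_a; have := morton_franks_williams P HP m (a - w) beta _ vb b.
  by rewrite /column [_ + (a - w)]addrC subrK; apply; lia.
have hi0 a b : hi < a -> Pd a b = 0.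
  move=> lt_a; have := morton_franks_williams P HP m (a - w - (m * m.+1)%N%:Z)
    (beta ++ full_twist m) _ _ b.
  rewrite /column expsum_cat eD -/w EPd.
  rewrite (_ : w + _ + _ = a); last by ring.
  by apply; rewrite ?valid_cat ?vb //; lia.
have main b : Pb lo b = (-1) ^+ m * Pd hi b.
  have /eqP := column_defect0 P HP m beta vb b.
  rewrite /column_defect subr_eq0 /column expsum_cat eD EPd => /eqP.
  rewrite (_ : expsum beta - m%:Z = lo); last by rewrite /lo /w; lia.
  (* Here [n ^ 2 - 1 = m * m.+1 + m]: the exponent sum of the full twist plus the index of the top
     column. *)
  by rewrite (_ : expsum beta + _ + m = hi) //; rewrite /hi /w; lia.
(* By [lo0] and [hi0], sharpness amounts to a non-zero extreme column, which [main] transfers both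
   ways. *)
split=> //; split=> -[[b nz] _]; split=> //; exists b.
  by apply: contraNneq nz; rewrite main => ->; rewrite mulr0.
by rewrite main mulf_neq0 // expf_neq0.
Qed.
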